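(* Suppose $2^{\omega}=\omega^{+}$. Let $F$ be the free group on $k$ generators $x_1,\dots,x_k$ ($k$ a finite number), let $D$ be a nonprincipal ultrafilter on $\omega$, let $F^*=\prod_{i\in\omega}F/D$ and $\mathbb Z^*=\prod_{i\in\omega}\mathbb Z/D$ be the corresponding ultrapowers, and let $\widetilde F=F(\mathbb Z^* )$ be the nonstandard free group with respect to $\widetilde{\mathbb Z}=\mathbb Z^*\equiv\mathbb Z$. Then $F^*\cong\widetilde F$ as groups.
   Context: An absolute interpretation $\Gamma$ of an $L$-structure $\mathbb A$ in a structure $\mathbb B$ is a family of parameter-free formulas of the language of $\mathbb B$: $U_\Gamma(\bar x)$, $E_\Gamma(\bar x,\bar x')$ and $Q_\Gamma$ for each symbol $Q\in L$ (in $n$-tuples of variables), such that $E_\Gamma$ defines an equivalence relation on the set $U_\Gamma(\mathbb B)\subseteq B^n$, the $Q_\Gamma$ define (the preimages of the graphs of) constants, operations and relations on the quotient, and the resulting $L$-structure $\Gamma(\mathbb B)$ is isomorphic to $\mathbb A$. For $\widetilde{\mathbb B}\equiv\mathbb B$ the same formulas define an $L$-structure $\Gamma(\widetilde{\mathbb B})$. The free group $F$ is absolutely interpreted in the ring $\mathbb Z$ as follows: a reduced word $x_{i_1}^{\varepsilon_1}\cdots x_{i_n}^{\varepsilon_n}$ corresponds to the finite tuple of integers $(\varepsilon_1 i_1,\dots,\varepsilon_n i_n)$ (the identity to the empty tuple), finite tuples of integers being coded by single numbers by means of a computable enumeration of finite tuples, which is arithmetically definable. Multiplication is concatenation of tuples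 followed by removal of the longest segment of the form $(d_\ell,\dots,d_1,-d_1,\dots,-d_\ell)$ symmetric about the concatenation point. For $\widetilde{\mathbb Z}\equiv\mathbb Z$, the nonstandard free group $F(\widetilde{\mathbb Z})$ is the group $\Gamma(\widetilde{\mathbb Z})$ defined in $\widetilde{\mathbb Z}$ by the formulas of this interpretation $\Gamma$. (Up to isomorphism it does not depend on the choice of the absolute interpretation $\Gamma$ of $F$ in $\mathbb Z$.) *)

(* Defs.v *)
From HB Require Import structures.
From mathcomp Require Import all_boot all_algebra.
From mathcomp Require Import boolp classical_sets functions cardinality filter.

Set Implicit Arguments.
Unset Strict Implicit.
Unset Printing Implicit Defensive.

Import GRing.Theory.

Local Open Scope classical_set_scope.

(* The cardinal of B is the successor of the cardinal of A: it is the least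
   cardinal strictly above that of A. *)
Definition card_lt (T U : Type) (A : set T) (B : set U) : Prop :=
  (A #<= B)%card /\ ~~ (B #<= A)%card.

Definition successor_card (T U : Type) (A : set T) (B : set U) : Prop :=
  card_lt A B /\
  forall (V : Type) (C : set V), card_lt A C -> (B #<= C)%card.

Definition nonprincipal (T : Type) (D : set_system T) : Prop :=
  forall x : T, D <> principal_filter x.

(* The quotient of T by a relation R, meant for equivalence relations: its
   elements are the classes R x. *)
Definition quot (T : Type) (R : T -> T -> Prop) : Type :=
  {C : set T | exists x, C = R x}.

Definition quot_pi (T : Type) (R : T -> T -> Prop) (x : T) : quot R :=
  exist _ (R x) (ex_intro _ x erefl).

Definition quot_repr (T : Type) (R : T -> T -> Prop) (c : quot R) : T :=
  projT1 (cid (proj2_sig c)).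

Record language := Language {
  fsym : Type;
  farity : fsym -> nat;
  rsym : Type;
  rarity : rsym -> nat }.

Record structure (L : language) := Structure {
  carrier :> Type;
  fint : forall f : fsym L, ('I_(farity f) -> carrier) -> carrier;
  rint : forall r : rsym L, ('I_(rarity r) -> carrier) -> Prop }.

Arguments fint {L} s f _.
Arguments rint {L} s r _.

(* Terms and formulas with free variables in V.  Under a quantifier, the bound
   variable is None : option V.  The connectives False, -> and forall suffice
   since satisfaction is classical.  There are no parameters. *)
Inductive term (L : language) (V : Type) : Type :=
| Var of V
| App (f : fsym L) of ('I_(farity f) -> term L V).

Inductive formula (L : language) (V : Type) : Type :=
| Bot
| Eq of term L V & term L V
| Rel (r : rsym L) of ('I_(rarity r) -> term L V)
| Imp of formula L V & formula L V
| All of formula L (option V).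

Fixpoint eval (L : language) (V : Type) (B : structure L) (e : V -> B)
    (t : term L V) : B :=
  match t with
  | Var v => e v
  | App f a => fint B f (fun i => eval e (a i))
  end.

Fixpoint sat (L : language) (V : Type) (B : structure L) (e : V -> B)
    (p : formula L V) {struct p} : Prop :=
  match p with
  | Bot => False
  | Eq t u => eval e t = eval e u
  | Rel r a => rint B r (fun i => eval e (a i))
  | Imp p q => sat e p -> sat e q
  | All p => forall b : B, sat (fun v => oapp e b v) p
  end.

Record iso (L : language) (A B : structure L) (h : A -> B) : Prop := Iso {
  iso_bij : bijective h;
  iso_fint : forall f a, h (fint A f a) = fint B f (h \o a);
  iso_rint : forall r a, rint A r a <-> rint B r (h \o a) }.

Definition isomorphic (L : language) (A B : structure L) : Prop :=
  exists h : A -> B, iso h.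

(* The ultrapower A^I / D (a filter D is enough for independence of the chosen
   representatives). *)
Definition eq_mod (I T : Type) (D : set_system I) (x y : I -> T) : Prop :=
  D [set i | x i = y i].

Definition ultrapower (I : Type) (D : set_system I) (L : language)
    (A : structure L) : structure L :=
  {| carrier := quot (@eq_mod I A D);
     fint f a := quot_pi (@eq_mod I A D)
       (fun i => fint A f (fun j => quot_repr (a j) i));
     rint r a := D [set i | rint A r (fun j => quot_repr (a j) i)] |}.

(* A parameter-free n-dimensional interpretation of L in L'.  The variable
   (j, i) is the i-th coordinate of the j-th tuple.  In eqF, j = true and
   j = false are the first and the second tuple.  In funF f, Some j is the
   j-th argument of f and None is its value. *)
Record interpretation (L L' : language) (n : nat) := Interpretation {
  domF : formula L' 'I_n;
  eqF : formula L' (bool * 'I_n);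
  funF : forall f : fsym L, formula L' (option 'I_(farity f) * 'I_n);
  relF : forall r : rsym L, formula L' ('I_(rarity r) * 'I_n) }.

Section Interpreted.
Variables (L L' : language) (n : nat) (G : interpretation L L' n).
Variable B : structure L'.

Definition Idom : Type := {x : 'I_n -> B | sat x (domF G)}.

Definition Ieq (x y : Idom) : Prop :=
  sat (fun v => (if v.1 then sval x else sval y) v.2) (eqF G).

Definition Ifun (f : fsym L) (x : 'I_(farity f) -> Idom) (y : Idom) : Prop :=
  sat (fun v => sval (oapp x y v.1) v.2) (funF G f).

Definition Irel (r : rsym L) (x : 'I_(rarity r) -> Idom) : Prop :=
  sat (fun v => sval (x v.1) v.2) (relF G r).

(* Ifun f is the preimage in Idom of the graph of an operation on the quotient
   by Ieq, and Irel r that of a relation. *)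
Record defines : Prop := Defines {
  Ieq_refl : forall x, Ieq x x;
  Ieq_sym : forall x y, Ieq x y -> Ieq y x;
  Ieq_trans : forall x y z, Ieq x y -> Ieq y z -> Ieq x z;
  Ifun_total : forall f x, exists y, @Ifun f x y;
  Ifun_unique : forall f x y y', @Ifun f x y -> @Ifun f x y' -> Ieq y y';
  Ifun_compat : forall f x x' y y', (forall j, Ieq (x j) (x' j)) ->
    Ieq y y' -> @Ifun f x y -> @Ifun f x' y';
  Irel_compat : forall r x x', (forall j, Ieq (x j) (x' j)) ->
    @Irel r x -> @Irel r x' }.

Definition interpreted (d : defines) : structure L :=
  {| carrier := quot Ieq;
     fint f c := quot_pi Ieq
       (projT1 (cid (@Ifun_total d _ (fun j => quot_repr (c j)))));
     rint r c := Irel (fun j => quot_repr (c j)) |}.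

End Interpreted.

Inductive ring_fsym := RZero | ROne | RAdd | ROpp | RMul.

Definition ring_language : language :=
  {| fsym := ring_fsym;
     farity f := match f with RZero | ROne => 0 | ROpp => 1 | _ => 2 end;
     rsym := void;
     rarity r := match r with end |}.

Definition ring_structure (R : pzRingType) : structure ring_language :=
  @Structure ring_language R
    (fun f => match f return ('I_(@farity ring_language f) -> R) -> R with
      | RZero => fun _ => 0%R
      | ROne => fun _ => 1%R
      | RAdd => fun a => (a ord0 + a ord_max)%R
      | ROpp => fun a => (- a ord0)%R
      | RMul => fun a => (a ord0 * a ord_max)%R
      end)
    (fun r => match r with end).

Inductive group_fsym := GOne | GMul | GInv.

Definition group_language : language :=
  {| fsym := group_fsym;
     farity f := match f with GOne => 0 | GMul => 2 | GInv => 1 end;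
     rsym := void;
     rarity r := match r with end |}.

Definition group_structure (H : groupType) : structure group_language :=
  @Structure group_language H
    (fun f => match f return ('I_(@farity group_language f) -> H) -> H with
      | GOne => fun _ => 1%g
      | GMul => fun a => (a ord0 * a ord_max)%g
      | GInv => fun a => (a ord0)^-1%g
      end)
    (fun r => match r with end).

Section FreeGroup.
Variable k : nat.

(* (i, false) is the generator x_(i+1) and (i, true) is its inverse. *)
Definition letter : Type := ('I_k * bool)%type.

Definition linv (a : letter) : letter := (a.1, ~~ a.2).

Definition reduced (w : seq letter) : bool :=
  sorted (fun a b => b != linv a) w.

Record free_group : Type := FreeGroup {
  word : seq letter;
  word_reduced : reduced word }.

HB.instance Definition _ := [isSub for word].
HB.instance Definition _ := [Choice of free_group by <:].

Definition push (a : letter) (w : seq letter) : seq letter :=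
  if w is b :: w' then if b == linv a then w' else a :: w else [:: a].

(* Free reduction of w ++ v when v is reduced. *)
Definition pushs (w v : seq letter) : seq letter := foldr push v w.

Lemma linvK : involutive linv.
Proof. by case=> i b; rewrite /linv /= negbK. Qed.

Lemma push_reduced a w : reduced w -> reduced (push a w).
Proof.
case: w => [|b w] //= bw; case: eqP => [_|/eqP nb]; first exact: path_sorted bw.
by rewrite /reduced /= nb.
Qed.

Lemma pushs_reduced w v : reduced v -> reduced (pushs w v).
Proof. by move=> v_red; elim: w => //= a w; apply: push_reduced. Qed.

Lemma pushK a w : reduced w -> push a (push (linv a) w) = w.
Proof.
case: w => [|b w] /=; first by rewrite eqxx.
rewrite linvK; case: eqP => [->|_ _]; last by rewrite /= eqxx.
by case: w => [|c w] //= /andP[/negPf->].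
Qed.

Lemma pushs_push a w v : reduced v -> pushs (push a w) v = push a (pushs w v).
Proof.
move=> v_red; case: w => [|b w] //=; case: eqP => [->|_] //=.
by rewrite pushK // pushs_reduced.
Qed.

Lemma pushsA u v w : reduced w -> pushs (pushs u v) w = pushs u (pushs v w).
Proof. by move=> w_red; elim: u => //= a u IH; rewrite pushs_push ?IH. Qed.

Lemma pushs0 w : reduced w -> pushs w [::] = w.
Proof.
elim: w => //= a w IH aw; rewrite IH; last exact: path_sorted aw.
by case: w aw {IH} => //= b w /andP[/negPf->].
Qed.

Definition word_inv (w : seq letter) : seq letter := rev (map linv w).

Lemma word_inv_reduced w : reduced w -> reduced (word_inv w).
Proof.
rewrite /reduced /word_inv rev_sorted sorted_map.
by apply: sub_sorted => a b /=; rewrite linvK eq_sym.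
Qed.

Lemma pushs_invl w : pushs (word_inv w) w = [::].
Proof.
elim: w => //= a w IH.
by rewrite /word_inv /= rev_cons /pushs foldr_rcons /= linvK eqxx.
Qed.

Lemma word_invK : involutive word_inv.
Proof.
by move=> w; rewrite /word_inv map_rev revK -map_comp map_id_in // => a _;
  rewrite /= linvK.
Qed.

Definition fg_one := FreeGroup (erefl : reduced [::]).
Definition fg_mul (x y : free_group) :=
  FreeGroup (pushs_reduced (word x) (word_reduced y)).
Definition fg_inv (x : free_group) :=
  FreeGroup (word_inv_reduced (word_reduced x)).

Lemma fg_mulA : associative fg_mul.
Proof.
by move=> x y z; apply: val_inj; rewrite /= pushsA // word_reduced.
Qed.

Lemma fg_mul1 : left_id fg_one fg_mul.
Proof. by move=> x; apply: val_inj. Qed.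

Lemma fg_mulr1 : right_id fg_one fg_mul.
Proof. by move=> x; apply: val_inj; rewrite /= pushs0 // word_reduced. Qed.

Lemma fg_mulV : left_inverse fg_one fg_inv fg_mul.
Proof. by move=> x; apply: val_inj; rewrite /= pushs_invl. Qed.

Lemma fg_mulrV : right_inverse fg_one fg_inv fg_mul.
Proof.
by move=> x; apply: val_inj; rewrite /= -{1}[word x]word_invK pushs_invl.
Qed.

HB.instance Definition _ :=
  isGroup.Build free_group fg_mulA fg_mul1 fg_mulr1 fg_mulV fg_mulrV.

End FreeGroup.

Local Open Scope ring_scope.

(* x_(i_1)^(e_1) ... x_(i_n)^(e_n) |-> (e_1 i_1, ..., e_n i_n), with
   generators numbered from 1. *)
Definition word_tuple (k : nat) (w : free_group k) : seq int :=
  [seq (-1) ^+ a.2 * (a.1.+1)%:Z | a : letter k <- word w].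

(* The last l entries of s followed by the first l entries of t have the form
   (d_l, ..., d_1, - d_1, ..., - d_l). *)
Definition cancels (s t : seq int) (l : nat) : bool :=
  drop (size s - l) s == rev [seq - d | d <- take l t].

Definition cancel_length (s t : seq int) : nat :=
  \max_(l < (minn (size s) (size t)).+1 | cancels s t l) l.

Definition tuple_mul (s t : seq int) : seq int :=
  take (size s - cancel_length s t) s ++ drop (cancel_length s t) t.

Definition tuple_op (f : fsym group_language) :
    ('I_(farity f) -> seq int) -> seq int :=
  match f with
  | GOne => fun _ => [::]
  | GMul => fun a => tuple_mul (a ord0) (a ord_max)
  | GInv => fun a => rev [seq - d | d <- a ord0]
  end.

Definition Zring : structure ring_language := ring_structure int.

(* Repetitions are allowed: the number n codes the tuple e n. *)
Definition enumeration (e : nat -> seq int) : Prop :=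
  forall s, exists n, e n = s.

(* The relation "v is the entry number i of the tuple number x" is definable
   in the ring Z by a formula phi(x, i, v). *)
Definition arithmetically_definable (e : nat -> seq int) : Prop :=
  exists phi : formula ring_language 'I_3, forall a : 'I_3 -> Zring,
    sat a phi <->
    exists x i : nat, [/\ a ord0 = x%:Z, a (inord 1) = i%:Z,
      (i < size (e x))%N & a ord_max = nth 0 (e x) i].

Definition codes (k : nat) (e : nat -> seq int) (x : int) (w : free_group k) :
    Prop :=
  exists2 n : nat, x = n%:Z & e n = word_tuple w.

(* The formulas of G define in Z the reduced words, the equality of words and
   the operations on words, all through the coding of tuples by e. *)
Record word_interpretation (k : nat) (e : nat -> seq int)
    (G : interpretation group_language ring_language 1) : Prop :=
  WordInterpretation {
    word_dom : forall x : 'I_1 -> Zring,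
      sat x (domF G) <-> exists w : free_group k, codes e (x ord0) w;
    word_eq : forall (x y : Idom G Zring) (u w : free_group k),
      codes e (sval x ord0) u -> codes e (sval y ord0) w ->
      Ieq x y <-> word_tuple u = word_tuple w;
    word_fun : forall (f : fsym group_language)
        (x : 'I_(farity f) -> Idom G Zring) (y : Idom G Zring)
        (u : 'I_(farity f) -> free_group k) (w : free_group k),
      (forall j, codes e (sval (x j) ord0) (u j)) ->
      codes e (sval y ord0) w ->
      Ifun x y <-> word_tuple w = tuple_op (fun j => word_tuple (u j)) }.

(* Main.v *)
(* Satisfaction in an ultrapower is satisfaction at almost every index (Łoś),
   so an interpretation of F in Z, read in Z^*, defines the D-limit of the
   structures it defines in Z: sending a point of the domain in Z^* to the class
   of the sequence of reduced words coded by its coordinates is onto F^*, and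
   turns the interpreted equality and operations into those of F^*. *)
Require Import Defs.
From mathcomp Require Import all_boot all_algebra.
From mathcomp Require Import boolp classical_sets functions cardinality filter.
From mathcomp Require Import zify.

Set Implicit Arguments.
Unset Strict Implicit.
Unset Printing Implicit Defensive.

Import GRing.Theory.

(** * Quotients by an equivalence relation *)

Section Quotient.
Variables (T : Type) (R : T -> T -> Prop).
Hypothesis R_refl : forall x, R x x.
Hypothesis R_sym : forall x y, R x y -> R y x.
Hypothesis R_trans : forall x y z, R x y -> R y z -> R x z.

Lemma quot_piP x y : quot_pi R x = quot_pi R y <-> R x y.
Proof.
split=> [|Rxy]; first by case=> ->.
apply: eq_exist; apply/funext => z; apply/propext.
by split; apply: R_trans => //; apply: R_sym.
Qed.

Lemma quot_reprK c : quot_pi R (quot_repr c) = c.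
Proof.
case: c => C C_cls; apply: eq_exist; rewrite /quot_repr.
by case: cid => x /= ->.
Qed.

Lemma quot_repr_pi x : R (quot_repr (quot_pi R x)) x.
Proof. by apply/quot_piP; rewrite quot_reprK. Qed.

End Quotient.

(** * Recognizing the interpreted structure through a surjection [W] of the domain onto [A] *)

Section InterpretedIso.
Variables (L L' : language) (n : nat) (G : interpretation L L' n).
Variables (B : structure L') (A : structure L) (W : Idom G B -> A).
Hypothesis W_onto : forall a, exists x, W x = a.
Hypothesis W_eq : forall x y, Ieq x y <-> W x = W y.
Hypothesis W_fun : forall f (x : 'I_(farity f) -> Idom G B) y,
  Ifun x y <-> W y = fint A f (W \o x).
Hypothesis W_rel : forall r (x : 'I_(rarity r) -> Idom G B),
  Irel x <-> rint A r (W \o x).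

(** Each clause is pulled back along [W] from equality, operations and relations in [A];
    surjectivity of [W] supplies the values of the operations. *)
Lemma defines_onto : defines G B.
Proof.
split=> [x|x y|x y z|f x|f x y y'|f x x' y y'|r x x'].
- exact/W_eq.
- by rewrite !W_eq.
- by rewrite !W_eq => ->.
- by have [y Wy] := W_onto (fint A f (W \o x)); exists y; apply/W_fun.
- by rewrite !W_fun W_eq => -> ->.
- move=> xx' /W_eq yy'; rewrite !W_fun -yy' => ->; congr (fint A f _).
  by apply/funext => j; apply/W_eq.
- move=> xx'; rewrite !W_rel; congr (rint A r _).
  by apply/funext => j; apply/W_eq.
Qed.

(** [W] induces a bijection from the quotient to [A]; the isomorphism is its inverse, sending [a] to
    the class of a chosen preimage [s a]. *)
Lemma interpreted_iso_onto (d : defines G B) : isomorphic A (interpreted d).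
Proof.
have piP x y : quot_pi (@Ieq _ _ _ G B) x = quot_pi (@Ieq _ _ _ G B) y <->
    W x = W y.
  rewrite quot_piP ?W_eq //; [exact: Ieq_refl d|exact: Ieq_sym d|].
  exact: Ieq_trans d.
pose s a := projT1 (cid (W_onto a)).
have sK a : W (s a) = a by rewrite /s; case: cid.
have repr_s a : W (quot_repr (quot_pi (@Ieq _ _ _ G B) (s a))) = a.
  by rewrite -[RHS]sK; apply/piP; rewrite quot_reprK.
pose h (a : A) : interpreted d := quot_pi (@Ieq _ _ _ G B) (s a).
exists h; split=> [|f a|r a].
- exists (fun c => W (quot_repr c)) => [a|c]; first exact: repr_s.
  by rewrite -[RHS]quot_reprK; apply/piP; rewrite sK.
- apply/piP; rewrite sK; case: cid => y /= /W_fun ->.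
  by congr (fint A f _); apply/funext => j; rewrite /= repr_s.
- rewrite /= W_rel; suff -> : W \o (fun j => quot_repr ((h \o a) j)) = a by [].
  by apply/funext => j; rewrite /= repr_s.
Qed.

End InterpretedIso.

(** * Łoś's theorem for ultrapowers *)

Section Ultrapower.
Variables (I : Type) (D : set_system I).
Context {ultraD : UltraFilter D}.
Local Open Scope classical_set_scope.

Lemma filter_near_iff (P Q : I -> Prop) :
  D [set i | P i <-> Q i] -> (D [set i | P i] <-> D [set i | Q i]).
Proof.
by move=> PQ; split; apply: filterS2 PQ => i /= ->.
Qed.

Section EqMod.
Variable T : Type.

Lemma eq_mod_refl (x : I -> T) : eq_mod D x x.
Proof. by apply: filterE. Qed.

Lemma eq_mod_sym (x y : I -> T) : eq_mod D x y -> eq_mod D y x.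
Proof. by apply: filterS. Qed.

Lemma eq_mod_trans (x y z : I -> T) :
  eq_mod D x y -> eq_mod D y z -> eq_mod D x z.
Proof. by apply: filterS2 => i /= ->. Qed.

Definition ultra_pi (x : I -> T) := quot_pi (@eq_mod I T D) x.

Lemma ultra_piP x y : ultra_pi x = ultra_pi y <-> D [set i | x i = y i].
Proof. exact: quot_piP eq_mod_refl eq_mod_sym eq_mod_trans x y. Qed.

Lemma repr_ultra_pi x : D [set i | quot_repr (ultra_pi x) i = x i].
Proof. exact: quot_repr_pi eq_mod_refl eq_mod_sym eq_mod_trans x. Qed.

End EqMod.

Variables (L : language) (A : structure L).

(** The chosen representatives agree with the given ones almost everywhere, simultaneously for all
    arguments because arities are finite. *)
Lemma fint_ultra_pi f (x : 'I_(farity f) -> I -> A) :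
  fint (ultrapower D A) f (fun j => ultra_pi (x j)) =
  ultra_pi (fun i => fint A f (x^~ i)).
Proof.
apply/ultra_piP.
by apply: filterS (filter_forall _ (fun j => repr_ultra_pi (x j))) => i xi;
  congr (fint A f _); apply/funext.
Qed.

Lemma rint_ultra_pi r (x : 'I_(rarity r) -> I -> A) :
  rint (ultrapower D A) r (fun j => ultra_pi (x j)) <->
  D [set i | rint A r (x^~ i)].
Proof.
apply: filter_near_iff.
apply: filterS (filter_forall _ (fun j => repr_ultra_pi (x j))) => i xi /=.
by have -> : (fun j => quot_repr (ultra_pi (x j)) i) = x^~ i by apply/funext.
Qed.

Lemma eval_ultra_pi V (x : V -> I -> A) (t : term L V) :
  @eval L V (ultrapower D A) (fun v => ultra_pi (x v)) t =
  ultra_pi (fun i => eval (x^~ i) t).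
Proof.
elim: t => [v|f a IH] //=; rewrite -fint_ultra_pi.
by congr (@fint _ (ultrapower D A) f _); apply/funext.
Qed.

(** Łoś's theorem, by induction on the formula with [V] varying, since a quantifier passes to
    [option V]. *)
Lemma sat_ultra_pi V (x : V -> I -> A) (p : formula L V) :
  @sat L V (ultrapower D A) (fun v => ultra_pi (x v)) p <->
  D [set i | sat (x^~ i) p].
Proof.
elim: p x => {V} [V|V t u|V r a|V p IHp q IHq|V p IH] x /=.
- by split=> // /filter_not_empty.
- by rewrite !eval_ultra_pi ultra_piP.
- have := rint_ultra_pi (fun j i => eval (x^~ i) (a j)).
  by rewrite -(funext (fun j => eval_ultra_pi x (a j))).
- rewrite IHp IHq; split=> [pq|];
    last by move=> + Dp; apply: filterS2 Dp => i /=; auto.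
  (* The ultrafilter decides [p]: if it fails almost everywhere, the implication holds there
     vacuously. *)
  have [Dp|nDp] := in_ultra_setVsetC [set i | sat (x^~ i) p] ultraD.
    by apply: filterS (pq Dp) => i /= qi _.
  by apply: filterS nDp => i /=.
- have ext (b : I -> A) :
      @sat L _ (ultrapower D A)
        (fun v => oapp (fun v => ultra_pi (x v)) (ultra_pi b) v) p <->
      D [set i | sat (fun v => oapp (x^~ i) (b i) v) p].
    have := IH (fun v => oapp x b v).
    have -> : (fun v => ultra_pi (oapp x b v)) =
        fun v => oapp (fun v => ultra_pi (x v)) (ultra_pi b) v.
      by apply/funext; case.
    move=> ->; apply: filter_near_iff; apply: filterE => i /=.
    have -> // : (fun v => oapp x b v i) = fun v => oapp (x^~ i) (b i) v.
    by apply/funext; case.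
  split=> [all_p|Dp b]; last first.
    rewrite -[b]quot_reprK; apply/ext.
    by apply: filterS Dp => i; apply.
  (* Otherwise counterexamples exist at almost every index; chosen pointwise, they form a sequence
     whose class contradicts [all_p]. The value [b0] serves as default at the other indices. *)
  have [//|nD] := in_ultra_setVsetC
    [set i | forall b, sat (fun v => oapp (x^~ i) b v) p] ultraD.
  have [i0 /existsNP[b0 _]] := filter_ex nD.
  have /choice[b bP] : forall i, exists b,
      ~ (forall b, sat (fun v => oapp (x^~ i) b v) p) ->
      ~ sat (fun v => oapp (x^~ i) b v) p.
    move=> i; have [[b nb]|nb] :=
      pselect (exists b, ~ sat (fun v => oapp (x^~ i) b v) p); first by exists b.
    by exists b0 => /existsNP/nb.
  have /ext := all_p (ultra_pi b).
  by apply: filterS2 nD => i /= nP Pb; case: (bP _ nP).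
Qed.

Lemma sat_ultrapower V (x : V -> ultrapower D A) (p : formula L V) :
  sat x p <-> D [set i | sat (fun v => quot_repr (x v) i) p].
Proof.
rewrite -sat_ultra_pi (_ : (fun v => ultra_pi _) = x) //.
by apply/funext => v; apply: quot_reprK.
Qed.

End Ultrapower.

(** * Reduced words and their integer tuples *)

Section Words.
Variable k : nat.
Local Open Scope ring_scope.

Definition letter_int (a : letter k) : int := (-1) ^+ a.2 * (a.1.+1)%:Z.

(** Generators are numbered from 1, so the integer is nonzero and its sign determines the
    exponent. *)
Lemma letter_int_inj : injective letter_int.
Proof.
case=> i b [j c]; rewrite /letter_int /=.
by case: b c => [] []; rewrite ?expr1 ?expr0 ?mulN1r ?mul1r //;
  [move=> /oppr_inj|]; case=> /val_inj ->.
Qed.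

Lemma letter_int_linv a : letter_int (linv a) = - letter_int a.
Proof. by rewrite /letter_int /=; case: a.2; rewrite ?expr1 ?mulN1r ?opprK ?mul1r. Qed.

Lemma word_tupleE (w : free_group k) : word_tuple w = map letter_int (word w).
Proof. by []. Qed.

Lemma word_tuple_inj : injective (@word_tuple k).
Proof.
by move=> u w; rewrite !word_tupleE => /(inj_map letter_int_inj)/val_inj.
Qed.

Lemma map_word_inv (w : seq (letter k)) :
  map letter_int (word_inv w) = rev [seq - d | d <- map letter_int w].
Proof.
rewrite /word_inv map_rev -!map_comp; congr rev.
by apply: eq_map => a /=; rewrite letter_int_linv.
Qed.

Lemma size_word_inv (w : seq (letter k)) : size (word_inv w) = size w.
Proof. by rewrite size_rev size_map. Qed.

Lemma word_inv_cons a (w : seq (letter k)) :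
  word_inv (a :: w) = rcons (word_inv w) (linv a).
Proof. by rewrite /word_inv /= rev_cons. Qed.

(** The middle cancels from the inside out: after the tail of [c] is gone, its head meets its own
    inverse. *)
Lemma pushs_cancel (p c q : seq (letter k)) :
  pushs (p ++ c) (word_inv c ++ q) = pushs p q.
Proof.
rewrite /pushs foldr_cat; congr foldr; rewrite -/(pushs _ _).
elim: c q => //= a c IH q.
by rewrite word_inv_cons cat_rcons IH /= eqxx.
Qed.

Lemma size_pushs (w v : seq (letter k)) : (size (pushs w v) <= size w + size v)%N.
Proof.
elim: w => //= a w IH; rewrite addSn.
apply: (@leq_trans (size (pushs w v)).+1) => //.
by rewrite /push; case: pushs => //= b s; case: ifP => // _; rewrite ltnW.
Qed.

(* c is the segment cancelled at the concatenation point. *)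
Lemma pushs_split (w v : seq (letter k)) : reduced w ->
  exists p c q, [/\ w = p ++ c, v = word_inv c ++ q & pushs w v = p ++ q].
Proof.
elim: w => [|a w IH] aw; first by exists [::], [::], v.
have [p [c [q [wE vE wvE]]]] := IH (path_sorted aw).
(* If [p] is nonempty, [a] is pushed onto its successor in a reduced word and cannot cancel. If [p]
   is empty, [a] meets the head of [q], and the cancelled segment may grow by [a]. *)
rewrite /= wvE; case: p => [|b p] in wE wvE *.
  case: q => [|b q] in vE wvE *; first by exists [:: a], c, [::]; rewrite wE.
  rewrite /=; case: eqP => [bE|_]; last by exists [:: a], c, (b :: q); rewrite wE.
  exists [::], (a :: c), q.
  by rewrite word_inv_cons cat_rcons -bE wE.
exists (a :: b :: p), c, q; split=> //; first by rewrite wE.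
by move: aw; rewrite wE /= => /andP[/negPf->].
Qed.

(** Since [letter_int] is injective and turns inverses into negatives, a symmetric segment of
    integers comes from one of letters. *)
Lemma cancelsP (w v : seq (letter k)) l :
  (l <= size w)%N -> (l <= size v)%N ->
  cancels (map letter_int w) (map letter_int v) l ->
  exists p c q, [/\ w = p ++ c, v = word_inv c ++ q & size c = l].
Proof.
move=> lw lv; rewrite /cancels size_map -map_take -map_word_inv -map_drop.
move=> /eqP/(inj_map letter_int_inj) wv.
exists (take (size w - l) w), (drop (size w - l) w), (drop l v).
by rewrite wv word_invK !cat_take_drop -wv cat_take_drop size_drop subKn.
Qed.

(** The segment [c] removed by free reduction is the longest symmetric one, so [cancel_length] is
    its length. *)
Lemma tuple_mul_map (w v : seq (letter k)) : reduced w ->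
  tuple_mul (map letter_int w) (map letter_int v) =
  map letter_int (pushs w v).
Proof.
move=> w_red; have [p [c [q [wE vE wvE]]]] := pushs_split v w_red.
set s := map _ w; set t := map _ v.
have cw : (size c <= size w)%N by rewrite wE size_cat leq_addl.
have cv : (size c <= size v)%N by rewrite vE size_cat size_word_inv leq_addr.
have cancels_c : cancels s t (size c).
  rewrite /cancels size_map -map_take -map_word_inv -map_drop; apply/eqP.
  congr map; rewrite wE vE size_cat addnK drop_size_cat // take_size_cat.
    by rewrite word_invK.
  by rewrite size_word_inv.
rewrite /tuple_mul; have -> : cancel_length s t = size c.
  rewrite /cancel_length; apply/eqP; rewrite eqn_leq; apply/andP; split.
    apply/bigmax_leqP => -[l l_lt] /= st_l; move: l_lt.
    rewrite ltnS leq_min !size_map => /andP[lw lv].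
    have [p' [c' [q' [wE' vE' <-]]]] := cancelsP lw lv st_l.
    (* Cancelling more than c would leave a product shorter than p ++ q. *)
    have := size_pushs p' q'.
    rewrite -(pushs_cancel p' c' q') -wE' -vE' wvE size_cat.
    have := congr1 size wE; rewrite {1}wE' !size_cat.
    have := congr1 size vE; rewrite {1}vE' !size_cat !size_word_inv.
    lia.
  have c_lt : (size c < (minn (size s) (size t)).+1)%N.
    by rewrite ltnS leq_min !size_map cw.
  by rewrite -[size c]/(val (Ordinal c_lt)) leq_bigmax_cond.
rewrite size_map -map_take -map_drop -map_cat wvE; congr map.
by rewrite wE vE size_cat addnK take_size_cat // drop_size_cat // size_word_inv.
Qed.

(** Links the tuple operations of [word_fun] with the group operations of the free group. *)
Lemma word_tuple_fint f
    (u : 'I_(@farity group_language f) -> group_structure (free_group k)) :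
  word_tuple (fint (group_structure (free_group k)) f u) =
  tuple_op (fun j => word_tuple (u j)).
Proof.
case: f u => u; rewrite !word_tupleE //=.
- by rewrite tuple_mul_map // word_reduced.
- by rewrite map_word_inv.
Qed.

End Words.

(** * The formulas of the interpretation, read on codes in the standard integers *)

Section Coding.
Variables (k : nat) (e : nat -> seq int).
Variable G : interpretation group_language ring_language 1.
Hypothesis interp_G : word_interpretation k e G.

(** A word may have several codes, but [word_tuple] is injective, so a code determines its word. *)
Lemma codes_inj x (u w : free_group k) : codes e x u -> codes e x w -> u = w.
Proof.
by move=> [m -> eu] [n [mn] ew]; apply: word_tuple_inj; rewrite -eu mn.
Qed.

(** Stated for bare valuations, because a coordinate of a point of the domain over the ultrapower
    lies in the standard domain only almost everywhere; having a code restores membership. *)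
Lemma codes_eqF (a : bool -> 'I_1 -> Zring) (u w : free_group k) :
  codes e (a true ord0) u -> codes e (a false ord0) w ->
  sat (fun v => a v.1 v.2) (eqF G) <-> u = w.
Proof.
move=> au aw.
have dom b : sat (a b) (domF G).
  by apply/(word_dom interp_G); case: b; [exists u|exists w].
pose pt b : Idom G Zring := exist (fun x => sat x (domF G)) (a b) (dom b).
have := word_eq interp_G (x := pt true) (y := pt false) au aw.
rewrite /Ieq /=.
have -> : (fun v => (if v.1 then a true else a false) v.2) =
  fun v : bool * 'I_1 => a v.1 v.2 by apply/funext => -[[] j].
by move=> ->; split=> [/word_tuple_inj|->].
Qed.

Lemma codes_funF f (a : option 'I_(farity f) -> 'I_1 -> Zring)
    (u : 'I_(farity f) -> group_structure (free_group k)) (w : free_group k) :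
  (forall j, codes e (a (Some j) ord0) (u j)) -> codes e (a None ord0) w ->
  sat (fun v => a v.1 v.2) (funF G f) <->
  w = fint (group_structure (free_group k)) f u.
Proof.
move=> au aw.
have dom o : sat (a o) (domF G).
  by apply/(word_dom interp_G); case: o => [j|]; [exists (u j)|exists w].
pose pt o : Idom G Zring := exist (fun x => sat x (domF G)) (a o) (dom o).
have := word_fun interp_G (x := fun j => pt (Some j)) (y := pt None) au aw.
rewrite /Ifun /= -word_tuple_fint.
set env := fun v => sval _ v.2.
have -> : env = fun v => a v.1 v.2 by apply/funext => -[[j|] i].
by move=> ->; split=> [/word_tuple_inj|->].
Qed.

End Coding.

(** * The ultrapower of the free group as the nonstandard free group *)

Theorem theorem4p1
  (continuum_hypothesis : successor_card [set: nat] [set: nat -> bool])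
  (k : nat)
  (D : set_system nat) (ultraD : UltraFilter D) (nonprincipalD : nonprincipal D)
  (e : nat -> seq int) (enum_e : enumeration e)
  (def_e : arithmetically_definable e)
  (G : interpretation group_language ring_language 1)
  (interp_G : word_interpretation k e G) :
  exists d : defines G (ultrapower D Zring),
    isomorphic (ultrapower D (group_structure (free_group k)))
               (interpreted d).
Proof.
set F := group_structure (free_group k).
pose coord (c : quot (@eq_mod nat Zring D)) i := quot_repr c i : Zring.
(* By Łoś's theorem almost every coordinate of [x] codes a word; the empty word is the default
   elsewhere. *)
have /choice[W WP] : forall x : Idom G (ultrapower D Zring),
    exists w : nat -> F,
      D [set i | codes e (coord (sval x ord0) i) (w i)]%classic.
  move=> x; have /sat_ultrapower Dx := svalP x.
  have /choice[w wP] : forall i, exists w : F,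
      sat (fun v => coord (sval x v) i) (domF G) ->
      codes e (coord (sval x ord0) i) w.
    move=> i; have [[w xw]|nx] := pselect (exists w : F,
      codes e (coord (sval x ord0) i) w); first by exists w.
    by exists (@fg_one k) => /(word_dom interp_G)/nx.
  by exists w; apply: filterS Dx => i /wP.
pose W' x : ultrapower D F := ultra_pi D (W x).
have W'_onto a : exists x, W' x = a.
  (* The preimage of [a] is the class of a sequence of codes of the words of a representative. *)
  have /choice[n nP] := fun i => enum_e (word_tuple (quot_repr a i)).
  pose x (_ : 'I_1) : ultrapower D Zring := ultra_pi D (fun i => Posz (n i)).
  have coordx : D [set i | coord (x ord0) i = Posz (n i)]%classic.
    exact: repr_ultra_pi.
  have dom_x : sat x (domF G).
    apply/sat_ultra_pi; apply: filterE => i.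
    by apply/(word_dom interp_G); exists (quot_repr a i); exists (n i).
  pose pt : Idom G (ultrapower D Zring) :=
    exist (fun x => sat x (domF G)) x dom_x.
  exists pt; rewrite -[RHS]quot_reprK; apply/ultra_piP.
  apply: filterS2 (WP pt) coordx => i /= + xi.
  by rewrite xi => /codes_inj; apply; exists (n i).
have W'_eq x y : Ieq x y <-> W' x = W' y.
  rewrite /Ieq sat_ultrapower ultra_piP; apply: filter_near_iff.
  apply: filterS2 (WP x) (WP y) => i /= xi yi.
  rewrite -(codes_eqF interp_G
    (a := fun b j => coord (sval (if b then x else y) j) i) xi yi).
  have -> // : (fun v => quot_repr ((if v.1 then sval x else sval y) v.2) i) =
    fun v : bool * 'I_1 => coord (sval (if v.1 then x else y) v.2) i.
  by apply/funext => -[[]].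
have W'_fun f x y : @Ifun _ _ _ G (ultrapower D Zring) f x y <->
    W' y = fint (ultrapower D F) f (W' \o x).
  rewrite fint_ultra_pi /Ifun sat_ultrapower ultra_piP.
  apply: filter_near_iff.
  (* The arity is finite, so almost every index is good for all arguments at once. *)
  apply: filterS2 (filter_forall _ (fun j => WP (x j))) (WP y) => i /= xi yi.
  exact: (codes_funF interp_G (a := fun o j => coord (sval (oapp x y o) j) i)).
(* The group language has no relation symbols. *)
have W'_rel r x : @Irel _ _ _ G (ultrapower D Zring) r x <->
    rint (ultrapower D F) r (W' \o x) by case: r x.
exists (defines_onto W'_onto W'_eq W'_fun W'_rel).
exact: interpreted_iso_onto.
Qed.
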